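(* On $\mathbb{R}$, let $\mu=\mathcal{N}(0,1)$, $\nu=\mathcal{N}(0,\sigma^2)$ for $\sigma>0$, $c(x,y)=-xy$, and let Sinkhorn's algorithm with regularization parameter $\lambda>0$ be started at $\psi_0=0$. If $\lambda\le\sigma/5$, then for any integer $t\ge0$ the dual sub-optimality gap satisfies $$\delta_t\ge\frac{\sigma}{20}\Big(1-\frac{5\lambda}{\sigma}\Big)^t.$$
   Context: $\mathcal{N}(0,s^2)$ is the centered Gaussian measure on $\mathbb{R}$ with variance $s^2$. The $(c,\lambda)$-transforms are $$\phi^{c,\lambda}(y)=-\lambda\log\int \exp\Big(\frac{\phi(x)-c(x,y)}{\lambda}\Big)d\mu(x),\qquad \psi^{c,\lambda}(x)=-\lambda\log\int \exp\Big(\frac{\psi(y)-c(x,y)}{\lambda}\Big)d\nu(y).$$ Sinkhorn's iterates are $\phi_{t+1/2}=\psi_t^{c,\lambda}$, $\psi_{t+1}=\phi_{t+1/2}^{c,\lambda}$ for integers $t\ge0$. The dual functional is $$F(\phi,\psi)=\int\phi\,d\mu+\int\psi\,d\nu+\lambda\Big(1-\iint \exp\Big(\frac{\phi(x)+\psi(y)-c(x,y)}{\lambda}\Big)d\mu(x)d\nu(y)\Big),$$ and the dual sub-optimality gap is $\delta_t=\sup_{\phi\in L^\infty(\mu),\,\psi\in L^\infty(\nu)}F(\phi,\psi)-F(\phi_{t+1/2},\psi_t)$.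
   Formalization: The supremum defining the dual gap is taken over integrable potentials, L^1(mu) x L^1(nu), instead of L^infinity(mu) x L^infinity(nu); over bounded potentials the functional is identically -infinity when lambda <= sigma/5, so the gap would be -infinity and the claim false. *)

(* Defs.v *)
From HB Require Import structures.
From mathcomp Require Import all_boot all_order all_algebra.
From mathcomp Require Import all_classical all_reals all_analysis.

Set Implicit Arguments.
Unset Strict Implicit.
Unset Printing Implicit Defensive.

Import Order.TTheory GRing.Theory Num.Theory.
Import numFieldNormedType.Exports.

Local Open Scope classical_set_scope.
Local Open Scope ring_scope.

(* N(0, s^2): normal_prob takes the standard deviation s (not the variance)
   and is only Gaussian for s != 0. *)
Definition centered_gaussian (R : realType) (s : R) :
    probability (measurableTypeR R) R :=
  normal_prob 0 s.

Section entropic_duality.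
Context (d1 d2 : measure_display) (R : realType).
Context (X : measurableType d1) (Y : measurableType d2).
Context (mu : probability X R) (nu : probability Y R).
Variables (c : X -> Y -> R) (lambda : R).

(* Both transforms are real-valued: they are the (c, lambda)-transforms at the
   points where the exponential integral is finite and positive.  Where it is
   0 or +oo they take the value 0, by the conventions of fine and ln. *)
Definition left_transform (phi : X -> R) (y : Y) : R :=
  - lambda * ln (\int[mu]_x expR ((phi x - c x y) / lambda)).

Definition right_transform (psi : Y -> R) (x : X) : R :=
  - lambda * ln (\int[nu]_y expR ((psi y - c x y) / lambda)).

Fixpoint sinkhorn_psi (psi0 : Y -> R) (t : nat) : Y -> R :=
  if t is t'.+1 then left_transform (right_transform (sinkhorn_psi psi0 t'))
  else psi0.

(* phi_{t + 1/2} *)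
Definition sinkhorn_phi (psi0 : Y -> R) (t : nat) : X -> R :=
  right_transform (sinkhorn_psi psi0 t).

(* Extended-real valued, since the last integral may be +oo, in which case the
   functional is -oo (for 0 < lambda and integrable potentials). *)
Definition dual_functional (phi : X -> R) (psi : Y -> R) : \bar R :=
  (\int[mu]_x (phi x)%:E + \int[nu]_y (psi y)%:E +
   lambda%:E * (1 - \int[mu \x nu]_z
                      (expR ((phi z.1 + psi z.2 - c z.1 z.2) / lambda))%:E))%E.

(* The supremum is over L^1(mu) x L^1(nu), the natural domain of the
   functional.  It cannot be restricted to L^oo(mu) x L^oo(nu) for costs that
   are unbounded below: if exp (- c / lambda) is not (mu \x nu)-integrable, as
   for c x y = - (x * y), mu = N(0, 1), nu = N(0, sigma ^ 2) and
   lambda <= sigma, then the functional is -oo at every pair of bounded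
   potentials.  The optimal potentials are then quadratic functions. *)
Definition dual_value : \bar R :=
  ereal_sup [set v | exists (phi : X -> R) (psi : Y -> R),
    [/\ mu.-integrable setT (EFin \o phi), nu.-integrable setT (EFin \o psi)
      & v = dual_functional phi psi]].

Definition dual_gap (psi0 : Y -> R) (t : nat) : \bar R :=
  (dual_value -
   dual_functional (sinkhorn_phi psi0 t) (sinkhorn_psi psi0 t))%E.

End entropic_duality.

(* Main.v *)
(* The transform of a quadratic potential against a centered Gaussian is again
   quadratic, so with kappa = lambda / sigma every Sinkhorn iterate is
   psi_t(y) = k_t - (w_t - kappa) y^2 / (2 sigma), where w_0 = kappa and
   w_(t+1) = kappa + 1 / (kappa + 1 / w_t).  At such a pair the dual functional
   is sigma / 2 times kappa ln (w / kappa) - 1 / w - (w - kappa), and its value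
   at the fixed point r, given by r^2 = 1 + kappa r, bounds the supremum from
   below.  Then r - w_t >= r^(-4 t - 1), because one step divides r - w by
   r^2 (1 + kappa w) <= r^4, and the gap of the functional is at least
   sigma / 2 times (r - w_t)^2 / (r^2 w_t) >= r^(-8 t - 5).  Finally
   r^(-8) >= 1 - 5 kappa and r^5 <= 10 when kappa <= 1/5. *)
Require Import Defs.
From HB Require Import structures.
From mathcomp Require Import all_boot all_order all_algebra.
From mathcomp Require Import all_classical all_reals all_analysis.
From mathcomp Require Import measurable_realfun.
From mathcomp Require Import ring lra.
Set Implicit Arguments.
Unset Strict Implicit.
Unset Printing Implicit Defensive.
Import Order.TTheory GRing.Theory Num.Theory.
Import numFieldNormedType.Exports.
Local Open Scope classical_set_scope.
Local Open Scope ring_scope.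

(** * Gaussian integrals of exponentials of quadratic polynomials *)

Lemma ge0_integral_normal_prob (R : realType) (m s : R)
    (f : measurableTypeR R -> \bar R) :
    measurable_fun setT f -> (forall x, (0 <= f x)%E) ->
  (\int[normal_prob m s]_x f x =
   \int[lebesgue_measure]_x (f x * (normal_pdf m s x)%:E))%E.
Proof.
move=> mf f0; have dom := normal_prob_dominates m s.
rewrite -(Radon_Nikodym_SigmaFinite.change_of_variables dom)//.
have mg := measurable_int _ (Radon_Nikodym_SigmaFinite.f_integrable dom).
have mp : measurable_fun [set: measurableTypeR R] (fun x => (normal_pdf m s x)%:E).
  exact: (measurable_int _ (integrable_normal_pdf m s)).
apply: ae_eq_integral => //.
- exact: emeasurable_funM.
- exact: emeasurable_funM.
(* The Radon-Nikodym density and [normal_pdf] have the same integral over every measurable set,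
   hence agree almost everywhere. *)
- apply: ae_eqe_mul2l; apply: integral_ae_eq => //.
    exact: Radon_Nikodym_SigmaFinite.f_integrable.
  by move=> E _ mE; rewrite -Radon_Nikodym_SigmaFinite.f_integral.
Qed.

Lemma measurable_quadratic (R : realType) (a b k : R) :
  measurable_fun setT (fun x : measurableTypeR R => a * x ^+ 2 + b * x + k).
Proof.
by apply: measurable_funD => //; apply: measurable_funD; apply: measurable_funM.
Qed.

(** The term [a * x ^+ 2] changes the precision [1 / s ^+ 2] of the Gaussian into [D / s ^+ 2]; the
    term [b * x] shifts its mean. *)
Lemma complete_square (F : numFieldType) (s a b k x D : F) :
    s != 0 -> D != 0 -> D = 1 - 2 * a * s ^+ 2 ->
  a * x ^+ 2 + b * x + k + - (x - 0) ^+ 2 / (s ^+ 2 *+ 2) =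
  k + b ^+ 2 * s ^+ 2 / (2 * D) +
  - (x - b * s ^+ 2 / D) ^+ 2 / (s ^+ 2 / D *+ 2).
Proof.
move=> s0 D0 DE; have -> : a = (1 - D) / (2 * s ^+ 2) by rewrite DE; field.
by field; rewrite D0 s0.
Qed.

(* Completing the square turns the integrand into a multiple of the normal
   density with mean [b * s ^+ 2 / D] and standard deviation [s / sqrt D]. *)
Lemma integral_expR_quadratic_normal (R : realType) (s a b k D : R) :
    s != 0 -> D = 1 - 2 * a * s ^+ 2 -> 0 < D ->
  (\int[normal_prob 0 s]_x (expR (a * x ^+ 2 + b * x + k))%:E =
   (expR (k + b ^+ 2 * s ^+ 2 / (2 * D)) / Num.sqrt D)%:E)%E.
Proof.
move=> s0 DE D0; rewrite ge0_integral_normal_prob; last 2 first.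
- apply/measurable_EFinP/measurableT_comp => //; exact: measurable_quadratic.
- by move=> x; rewrite lee_fin expR_ge0.
have q0 : Num.sqrt D != 0 by rewrite gt_eqF// sqrtr_gt0.
have qD : Num.sqrt D ^+ 2 = D by rewrite sqr_sqrtr// ltW.
have s'0 : s / Num.sqrt D != 0 by rewrite mulf_neq0// invr_neq0.
have peakE : normal_peak s = normal_peak (s / Num.sqrt D) / Num.sqrt D.
  rewrite /normal_peak expr_div_n qD.
  have -> : s ^+ 2 / D * pi *+ 2 = (s ^+ 2 * pi *+ 2) / D.
    by rewrite mulrnAl mulrAC.
  have pi2_ge0 : 0 <= s ^+ 2 * pi *+ 2.
    by rewrite mulrn_wge0// mulr_ge0 ?sqr_ge0 ?pi_ge0.
  by rewrite sqrtrM// sqrtrV ?ltW// invfM invrK mulfK.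
transitivity (\int[lebesgue_measure]_x
   ((expR (k + b ^+ 2 * s ^+ 2 / (2 * D)) / Num.sqrt D)%:E *
    (normal_pdf (b * s ^+ 2 / D) (s / Num.sqrt D) x)%:E))%E.
  apply: eq_integral => x _; rewrite -!EFinM; congr EFin.
  rewrite !normal_pdfE// peakE.
  have -> : expR (a * x ^+ 2 + b * x + k) *
      (normal_peak (s / Num.sqrt D) / Num.sqrt D * normal_fun 0 s x) =
      normal_peak (s / Num.sqrt D) / Num.sqrt D *
      (expR (a * x ^+ 2 + b * x + k) * normal_fun 0 s x) by rewrite mulrCA.
  have -> : expR (a * x ^+ 2 + b * x + k) * normal_fun 0 s x =
      expR (k + b ^+ 2 * s ^+ 2 / (2 * D)) *
      normal_fun (b * s ^+ 2 / D) (s / Num.sqrt D) x.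
    rewrite /normal_fun -!expRD; congr expR.
    by rewrite expr_div_n qD; apply: complete_square => //; rewrite gt_eqF.
  by rewrite mulrACA [in RHS]mulrACA (mulrC (normal_peak _)).
rewrite ge0_integralZl//.
- by rewrite integral_normal_pdf mule1.
- exact: measurable_int (integrable_normal_pdf _ _).
- by move=> x _; rewrite lee_fin normal_pdf_ge0.
Qed.

(** * The second moment of a centered Gaussian *)

Lemma le_divr_sqrt (R : rcfType) (z D : R) :
  0 < D -> 0 <= z -> z <= 1 / Num.sqrt D -> z ^+ 2 * D <= 1.
Proof.
move=> D0 z0; rewrite ler_pdivlMr ?sqrtr_gt0// => zD.
have : (z * Num.sqrt D) ^+ 2 <= 1 by rewrite exprn_ile1// mulr_ge0// sqrtr_ge0.
by rewrite exprMn sqr_sqrtr// ltW.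
Qed.

(* The first-order terms of both bounds as [e] tends to 0 are [e * v]. *)
Lemma second_moment_sandwich (R : rcfType) (m v : R) : 0 < v -> 0 <= m ->
    (forall e, 0 < e -> 2 * e * v < 1 -> 1 + e * m <= 1 / Num.sqrt (1 - 2 * e * v)) ->
    (forall e, 0 < e -> 1 <= 1 / Num.sqrt (1 + 2 * e * v) + e * m) ->
  m = v.
Proof.
move=> v0 m0 up lo; apply/eqP; rewrite eq_le; apply/andP; split.
- rewrite leNgt; apply/negP => vm.
  have m'0 : 0 < m by apply: lt_trans vm.
  (* With this [e] the cross term [e * (4 * m * v)] cancels half of the first-order coefficient
     [2 * (m - v)], and the product expanded below exceeds 1. *)
  pose e := (m - v) / (4 * m * v).
  have eE : e * (4 * m * v) = m - v by rewrite /e; field; rewrite !gt_eqF.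
  have e0 : 0 < e by rewrite divr_gt0 ?subr_gt0// !mulr_gt0.
  have ev : 2 * e * v < 1.
    rewrite -(ltr_pM2r m'0); nra.
  have D0 : 0 < 1 - 2 * e * v by lra.
  have em0 : 0 <= e * m by rewrite mulr_ge0// ltW.
  have := le_divr_sqrt D0 _ (up _ e0 ev); rewrite addr_ge0// => /(_ isT).
  have -> : (1 + e * m) ^+ 2 * (1 - 2 * e * v) =
    1 + e * (2 * (m - v) - e * (4 * m * v)) + e ^+ 2 * m ^+ 2 * (1 - 2 * e * v).
    ring.
  rewrite eE; have : 0 < e * (m - v) by rewrite mulr_gt0// subr_gt0.
  have : 0 <= e ^+ 2 * m ^+ 2 * (1 - 2 * e * v).
    exact: mulr_ge0 (mulr_ge0 (sqr_ge0 _) (sqr_ge0 _)) (ltW D0).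
  lra.
- rewrite leNgt; apply/negP => mv.
  (* Here [m] may be 0, so the denominator has [v ^+ 2] in place of [m * v]; the difference is the
     nonnegative term [4 * e ^+ 2 * v * (v - m)]. *)
  pose e := (v - m) / (4 * v ^+ 2).
  have eE : e * (4 * v ^+ 2) = v - m by rewrite /e; field; rewrite !gt_eqF.
  have e0 : 0 < e by rewrite divr_gt0 ?subr_gt0// mulr_gt0// exprn_gt0.
  have em0 : 0 <= e * m by rewrite mulr_ge0// ltW.
  have em1 : e * m <= 1.
    rewrite -(ler_pM2r v0); have : e * m * v <= e * v * v.
      by rewrite ler_pM2r// ler_pM2l// ltW.
    nra.
  have ev0 : 0 < e * v by rewrite mulr_gt0.
  have D0 : 0 < 1 + 2 * e * v by lra.
  have : 1 - e * m <= 1 / Num.sqrt (1 + 2 * e * v) by have := lo _ e0; lra.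
  move=> /(le_divr_sqrt D0); rewrite subr_ge0 => /(_ em1).
  have -> : (1 - e * m) ^+ 2 * (1 + 2 * e * v) =
    1 + e * (2 * (v - m) - e * (4 * v ^+ 2)) + 4 * e ^+ 2 * v * (v - m)
    + e ^+ 2 * m ^+ 2 * (1 + 2 * e * v).
    ring.
  rewrite eE; have : 0 < e * (v - m) by rewrite mulr_gt0// subr_gt0.
  have : 0 <= 4 * e ^+ 2 * v * (v - m).
    apply: mulr_ge0; last by rewrite subr_ge0 ltW.
    by apply/ltW/mulr_gt0; first exact: mulr_gt0 (exprn_gt0 _ _).
  have : 0 <= e ^+ 2 * m ^+ 2 * (1 + 2 * e * v).
    exact: mulr_ge0 (mulr_ge0 (sqr_ge0 _) (sqr_ge0 _)) (ltW D0).
  lra.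
Qed.

Section normal_second_moment.
Context (R : realType) (s : R).
Hypothesis s0 : s != 0.
Local Notation N := (normal_prob 0 s).
Local Open Scope ereal_scope.

Let sqr (x : measurableTypeR R) : \bar R := (x ^+ 2)%:E.

Let measurable_sqr : measurable_fun setT sqr.
Proof. by apply/measurable_EFinP; exact: measurable_funX. Qed.

Let sqr_nonneg x : 0 <= sqr x. Proof. by rewrite lee_fin sqr_ge0. Qed.

Let integral_expR_sqr (a : R) : (0 < 1 - 2 * a * s ^+ 2)%R ->
  \int[N]_x (expR (a * x ^+ 2))%:E =
  (1 / Num.sqrt (1 - 2 * a * s ^+ 2))%:E.
Proof.
move=> D0; under eq_integral.
  move=> x _; have -> : (a * x ^+ 2 = a * x ^+ 2 + 0 * x + 0)%R.
    by rewrite mul0r !addr0.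
  over.
rewrite (integral_expR_quadratic_normal _ _ s0 erefl D0).
by rewrite expr0n/= mul0r mul0r addr0 expR0.
Qed.

Let integral_add_sqr (f : measurableTypeR R -> R) (e : R) : (0 <= e)%R ->
    (forall x, 0 <= f x)%R -> measurable_fun setT f ->
  \int[N]_x (f x + e * x ^+ 2)%:E = \int[N]_x (f x)%:E + e%:E * \int[N]_x sqr x.
Proof.
move=> e0 f0 mf; rewrite -ge0_integralZl//.
rewrite -ge0_integralD//.
- by move=> x _; rewrite lee_fin.
- exact/measurable_EFinP.
- by move=> x _; rewrite mule_ge0// lee_fin.
- exact: measurable_funeM.
Qed.

(* [expR (e * x ^+ 2) >= 1 + e * x ^+ 2] is integrated for [e] of either sign,
   which avoids an integration by parts. *)
Lemma integral_sqr_normal : \int[N]_x (x ^+ 2)%:E = (s ^+ 2)%:E.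
Proof.
have v0 : (0 < s ^+ 2)%R by rewrite exprn_even_gt0.
have int1 : \int[N]_x 1%:E = 1.
  by rewrite integral_cst// mul1e; exact: (probability_setT N).
have up (e : R) : (0 < e)%R -> (2 * e * s ^+ 2 < 1)%R ->
    1 + e%:E * \int[N]_x sqr x <= (1 / Num.sqrt (1 - 2 * e * s ^+ 2))%:E.
  move=> e0 ev; rewrite -integral_expR_sqr ?subr_gt0// -{1}int1.
  rewrite -(integral_add_sqr (f := cst 1%R) (ltW e0))//.
  apply: ge0_le_integral => //.
  - by move=> x _; rewrite lee_fin addr_ge0// mulr_ge0 ?sqr_ge0// ltW.
  - apply/measurable_EFinP; apply: measurable_funD => //.
    by apply: measurable_funM => //; exact: measurable_funX.
  - apply/measurable_EFinP; apply: measurableT_comp => //.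
    by apply: measurable_funM => //; exact: measurable_funX.
  - by move=> x _; rewrite lee_fin expR_ge1Dx.
(* Putting [e * x ^+ 2] on the side of the exponential keeps every integrand nonnegative, as the
   second moment is not yet known to be finite. *)
have lo (e : R) : (0 < e)%R ->
    1 <= (1 / Num.sqrt (1 + 2 * e * s ^+ 2))%:E + e%:E * \int[N]_x sqr x.
  move=> e0.
  have DE : (1 - 2 * - e * s ^+ 2 = 1 + 2 * e * s ^+ 2)%R.
    by rewrite mulrN mulNr opprK.
  have D0 : (0 < 1 - 2 * - e * s ^+ 2)%R.
    by rewrite DE addr_gt0// mulr_gt0// mulr_gt0.
  rewrite -DE.
  have mexp : measurable_fun [set: measurableTypeR R] (fun x => expR (- e * x ^+ 2)).
    apply: measurableT_comp => //.
    by apply: measurable_funM => //; exact: measurable_funX.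
  rewrite -integral_expR_sqr// -{1}int1 -(integral_add_sqr (ltW e0) _ mexp); last first.
    by move=> x; exact: expR_ge0.
  apply: ge0_le_integral => //.
  - apply/measurable_EFinP; apply: measurable_funD => //.
    by apply: measurable_funM => //; exact: measurable_funX.
  - move=> x _; rewrite lee_fin -lerBlDr mulNr.
    exact: expR_ge1Dx.
have : 0 <= \int[N]_x sqr x by apply: integral_ge0.
move: up lo; rewrite -[X in X = _]/(\int[N]_x sqr x).
case: (\int[N]_x sqr x) => [m| |]//= up lo m0.
- by congr EFin; exact: second_moment_sandwich.
(* An infinite second moment contradicts [up] at any admissible [e]; this one gives
   [2 * e * s ^+ 2 = 1 / 2]. *)
- have e0 : (0 < (4 * s ^+ 2)^-1)%R by rewrite invr_gt0 mulr_gt0.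
  have e1 : (2 * (4 * s ^+ 2)^-1 * s ^+ 2 < 1)%R.
    have -> : (2 * (4 * s ^+ 2)^-1 * s ^+ 2 = 2^-1)%R by field.
    lra.
  by have := up _ e0 e1; rewrite gt0_muley ?lte_fin// addey// leye_eq.
Qed.

End normal_second_moment.

(** * Quadratic potentials and their soft transforms *)

(** A linear term never arises: the Gaussians are centered and the cost is odd in each variable, so
    even potentials have even transforms. *)
Definition quadratic (R : realType) (k q : R) (x : measurableTypeR R) : R :=
  k - q * x ^+ 2.

Lemma measurable_quadratic_fun (R : realType) (k q : R) :
  measurable_fun setT (quadratic k q).
Proof.
by apply: measurable_funB => //; apply: measurable_funM.
Qed.

Lemma integrable_sqr_normal (R : realType) (s : R) : s != 0 ->
  (normal_prob 0 s).-integrable setT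
    (fun x : measurableTypeR R => (x ^+ 2)%:E).
Proof.
move=> s0; apply/integrableP; split.
  by apply/measurable_EFinP; exact: measurable_funX.
under eq_integral do rewrite gee0_abs ?lee_fin ?sqr_ge0//.
by rewrite integral_sqr_normal// ltry.
Qed.

Lemma integrable_quadratic (R : realType) (s k q : R) : s != 0 ->
  (normal_prob 0 s).-integrable setT (EFin \o quadratic k q).
Proof.
move=> s0.
have -> : EFin \o quadratic k q =
    (cst k%:E \- (fun x : measurableTypeR R => q%:E * (x ^+ 2)%:E))%E.
  by apply/funext.
apply: integrableB => //; first exact: finite_measure_integrable_cst.
by apply: integrableZl => //; exact: integrable_sqr_normal.
Qed.

Lemma integral_cst_probability (d : measure_display) (T : measurableType d)
    (R : realType) (P : probability T R) (r : R) : (\int[P]_x r%:E = r%:E)%E.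
Proof.
by rewrite integral_cst// -[RHS]mule1; congr (_ * _)%E; exact: probability_setT.
Qed.

Lemma integral_quadratic (R : realType) (s k q : R) : s != 0 ->
  (\int[normal_prob 0 s]_x (quadratic k q x)%:E = (k - q * s ^+ 2)%:E)%E.
Proof.
move=> s0; under eq_integral do rewrite EFinB EFinM.
rewrite integralB//.
- rewrite integralZl//; last exact: integrable_sqr_normal.
  rewrite integral_sqr_normal//.
  by rewrite (integral_cst_probability (normal_prob 0 s)) EFinB EFinM.
- exact: finite_measure_integrable_cst.
- by apply: integrableZl => //; exact: integrable_sqr_normal.
Qed.

Lemma integral_expR_quadratic_cost (R : realType) (s lambda k q x D : R) :
    s != 0 -> 0 < lambda -> D = 1 + 2 * q * s ^+ 2 / lambda -> 0 < D ->
  (\int[normal_prob 0 s]_y (expR ((quadratic k q y + x * y) / lambda))%:E =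
   (expR (k / lambda + s ^+ 2 / (2 * lambda ^+ 2 * D) * x ^+ 2) /
    Num.sqrt D)%:E)%E.
Proof.
move=> s0 l0 DE D0.
have l0' : lambda != 0 by rewrite gt_eqF.
under eq_integral.
  move=> y _.
  have -> : (quadratic k q y + x * y) / lambda =
      (- q / lambda) * y ^+ 2 + x / lambda * y + k / lambda.
    by rewrite /quadratic; field.
  over.
rewrite (integral_expR_quadratic_normal (x / lambda) (k / lambda) s0 _ D0).
  congr (_ / _)%:E; congr expR; congr (_ + _); field.
  by rewrite l0' gt_eqF.
by rewrite DE; field.
Qed.

(** The factor [1 / Num.sqrt D] becomes the constant [lambda / 2 * ln D], and the mean shift caused
    by [x * y] becomes the new quadratic coefficient. Both transforms are instances, as the cost is
    symmetric. *)
Lemma soft_transform_quadratic (R : realType) (s lambda k q x D : R) :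
    s != 0 -> 0 < lambda -> D = 1 + 2 * q * s ^+ 2 / lambda -> 0 < D ->
  - lambda * ln (\int[normal_prob 0 s]_y
                   expR ((quadratic k q y + x * y) / lambda)) =
  quadratic (lambda / 2 * ln D - k) (s ^+ 2 / (2 * lambda * D)) x.
Proof.
move=> s0 l0 DE D0; rewrite /Rintegral.
rewrite (integral_expR_quadratic_cost k x s0 l0 DE D0)/=.
have q0 : 0 < Num.sqrt D by rewrite sqrtr_gt0.
rewrite ln_div ?posrE ?expR_gt0// expRK.
have -> : ln D = 2 * ln (Num.sqrt D).
  by rewrite -{1}[D]sqr_sqrtr ?ltW// lnXn// mulr_natl.
rewrite /quadratic; field.
by rewrite !gt_eqF.
Qed.

(** * Transforms and dual functional for the cost [- (x * y)] *)

Section gaussian_product_cost.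
Context (R : realType) (sigma lambda : R).
Hypotheses (sigma_gt0 : 0 < sigma) (lambda_gt0 : 0 < lambda).

Local Notation cost :=
  (fun x y : measurableTypeR R => (- (x * y))%R : Real.sort R).
Local Notation mu := (@centered_gaussian R 1).
Local Notation nu := (@centered_gaussian R sigma).

Let sigma_neq0 : sigma != 0. Proof. by rewrite gt_eqF. Qed.

Lemma right_transform_quadratic (k q D : R) :
    D = 1 + 2 * q * sigma ^+ 2 / lambda -> 0 < D ->
  right_transform nu cost lambda (quadratic k q) =
  quadratic (lambda / 2 * ln D - k) (sigma ^+ 2 / (2 * lambda * D)).
Proof.
move=> DE D0; apply/funext => x; rewrite /right_transform.
rewrite -(soft_transform_quadratic k x sigma_neq0 lambda_gt0 DE D0).
congr (_ * ln _); apply: eq_Rintegral => y _.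
by rewrite opprK.
Qed.

Lemma left_transform_quadratic (k q D : R) :
    D = 1 + 2 * q / lambda -> 0 < D ->
  left_transform mu cost lambda (quadratic k q) =
  quadratic (lambda / 2 * ln D - k) (1 / (2 * lambda * D)).
Proof.
move=> DE D0; apply/funext => y; rewrite /left_transform.
have DE' : D = 1 + 2 * q * 1 ^+ 2 / lambda by rewrite expr1n mulr1.
rewrite -[X in X / _](expr1n _ 2).
rewrite -(soft_transform_quadratic k y (oner_neq0 _) lambda_gt0 DE' D0).
congr (_ * ln _); apply: eq_Rintegral => x _.
by rewrite opprK (mulrC x).
Qed.

(* [right_transform] normalises the first marginal, so that the exponential
   term of the functional cancels. *)
Lemma dual_functional_quadratic (k q D : R) :
    D = 1 + 2 * q * sigma ^+ 2 / lambda -> 0 < D ->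
  dual_functional mu nu cost lambda
    (right_transform nu cost lambda (quadratic k q)) (quadratic k q) =
  (lambda / 2 * ln D - sigma ^+ 2 / (2 * lambda * D) - q * sigma ^+ 2)%:E.
Proof.
move=> DE D0; rewrite (right_transform_quadratic k DE D0) /dual_functional.
rewrite integral_quadratic ?oner_neq0// integral_quadratic//.
set k' := lambda / 2 * ln D - k; set p := sigma ^+ 2 / _.
have -> : (\int[mu \x nu]_z
    (expR ((quadratic k' p z.1 + quadratic k q z.2 - - (z.1 * z.2)) / lambda))%:E
    = 1)%E.
  rewrite (@fubini_tonelli1 _ _ _ _ _ mu nu); last 2 first.
  - apply/measurable_EFinP; apply: measurableT_comp => //.
    apply: measurable_funM => //; apply: measurable_funB; last first.
      by apply: measurableT_comp => //; apply: measurable_funM.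
    apply: measurable_funD.
      by apply: measurableT_comp => //; exact: measurable_quadratic_fun.
    by apply: measurableT_comp => //; exact: measurable_quadratic_fun.
  - by move=> z; rewrite lee_fin expR_ge0.
  rewrite /fubini_F/=.
  have q0 : 0 < Num.sqrt D by rewrite sqrtr_gt0.
  transitivity (\int[mu]_x (cst 1 x))%E; last first.
    exact: (integral_cst_probability mu).
  apply: eq_integral => x _.
  under eq_integral.
    move=> y _.
    have -> : (quadratic k' p x + quadratic k q y - - (x * y)) / lambda =
       (quadratic (k + quadratic k' p x) q y + x * y) / lambda.
      by rewrite opprK /quadratic; congr (_ / _); ring.
    over.
  rewrite (integral_expR_quadratic_cost _ x sigma_neq0 lambda_gt0 DE D0).
  (* The terms in [x ^+ 2] cancel and [k'] leaves half of [ln D], so the inner integral is 1 for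
     every [x]. *)
  have -> : (k + quadratic k' p x) / lambda +
      sigma ^+ 2 / (2 * lambda ^+ 2 * D) * x ^+ 2 = ln (Num.sqrt D).
    have lnD : ln D = 2 * ln (Num.sqrt D).
      by rewrite -{1}[D]sqr_sqrtr ?ltW// lnXn// mulr_natl.
    rewrite /quadratic /k' /p lnD; field.
    by rewrite !gt_eqF.
  by rewrite lnK ?posrE// divff// gt_eqF.
rewrite subee// mule0 adde0 -EFinD; congr EFin.
rewrite expr1n mulr1 /k'; ring.
Qed.

End gaussian_product_cost.

(* In the variable [w = sigma * b + kappa], where [psi y = k - b * y ^+ 2 / 2]
   and [kappa = lambda / sigma], a full Sinkhorn step is the map
   [w |-> kappa + 1 / (kappa + 1 / w)]; [psi = 0] corresponds to [w = kappa]. *)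
Definition sinkhorn_weight (R : realType) (kappa : R) (t : nat) : R :=
  iter t (fun w => kappa + (kappa + w^-1)^-1) kappa.

(** * The scalar recursion of the weights and its rate *)

Section sinkhorn_weight.
Context (R : realType) (kappa r : R).
Hypotheses (kappa_gt0 : 0 < kappa) (kappa_le : kappa <= 1 / 5).
Hypotheses (r_gt0 : 0 < r) (r_fixed : r ^+ 2 = 1 + kappa * r).
Local Notation w := (sinkhorn_weight kappa).

Lemma sinkhorn_weight_gt0 t : 0 < w t.
Proof.
by elim: t => //= t IH; rewrite addr_gt0// invr_gt0 addr_gt0 ?invr_gt0.
Qed.

(** A full step is [w |-> kappa + w^-1] applied twice, so a fixed point of this half step is fixed
    by the full step. *)
Lemma fixed_weightE : r = kappa + r^-1.
Proof.
apply: (mulIf (lt0r_neq0 r_gt0)).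
by rewrite mulrDl mulVf ?gt_eqF// -expr2 r_fixed addrC.
Qed.

(** The half step [h] satisfies [r - h w = (w - r) / (r * w)]; apply this twice and use
    [w * h w = 1 + kappa * w]. The exact identity gives both the sign of [r - w t] and its lower
    bound. *)
Lemma sinkhorn_weight_contraction t :
  r - w t.+1 = (r - w t) / (r ^+ 2 * (1 + kappa * w t)).
Proof.
have := sinkhorn_weight_gt0 t; rewrite /sinkhorn_weight iterS.
move: (iter _ _ _) => x x0.
have kx0 : 0 < 1 + kappa * x by rewrite addr_gt0// mulr_gt0.
have kr0 : 0 < 1 + kappa * r by rewrite addr_gt0// mulr_gt0.
have -> : (kappa + x^-1)^-1 = x / (1 + kappa * x).
  by field; rewrite !gt_eqF// addrC.
have rE : r = kappa + r / (1 + kappa * r).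
  rewrite -r_fixed expr2 invfM mulrA divff ?gt_eqF// mul1r.
  exact: fixed_weightE.
rewrite {1}rE r_fixed; field.
by rewrite !gt_eqF.
Qed.

Lemma sinkhorn_weight_lt t : w t < r.
Proof.
elim: t => [|t IH].
  by rewrite /= [ltRHS]fixed_weightE ltrDl invr_gt0.
rewrite -subr_gt0 sinkhorn_weight_contraction divr_gt0 ?subr_gt0//.
by rewrite mulr_gt0 ?exprn_gt0// addr_gt0// mulr_gt0// sinkhorn_weight_gt0.
Qed.

Lemma sinkhorn_weight_gap t : (r ^+ 4)^-1 ^+ t / r <= r - w t.
Proof.
elim: t => [|t IH].
  by rewrite expr0 mul1r /= [leRHS]addrC {2}fixed_weightE addKr.
rewrite sinkhorn_weight_contraction exprS -mulrA mulrC.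
have w0 := sinkhorn_weight_gt0 t.
have kw0 : 0 < 1 + kappa * w t by rewrite addr_gt0// mulr_gt0.
apply: ler_pM => //.
- by rewrite divr_ge0 ?exprn_ge0 ?invr_ge0 ?exprn_ge0// ltW.
- by rewrite invr_ge0 exprn_ge0// ltW.
- rewrite lef_pV2 ?posrE ?exprn_gt0 ?mulr_gt0 ?exprn_gt0//.
  rewrite (exprD r 2 2) ler_pM2l ?exprn_gt0// r_fixed lerD2l ler_pM2l//.
  exact/ltW/sinkhorn_weight_lt.
Qed.

(** The value [6 / 5] fits both uses: it is below the [5 / 4] that the rate requires, and its fifth
    power is below 10. *)
Lemma fixed_weight_le : r <= 6 / 5.
Proof.
rewrite leNgt; apply/negP => r65.
have : kappa * r <= 1 / 5 * r by rewrite ler_pM2r.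
have : 6 / 5 * r < r * r by rewrite ltr_pM2r.
have := r_fixed; rewrite expr2; lra.
Qed.

Lemma fixed_weight_expr5 : r ^+ 5 <= 10.
Proof.
apply: (@le_trans _ _ ((6 / 5) ^+ 5)); last by lra.
by rewrite lerXn2r ?nnegrE ?fixed_weight_le// ltW.
Qed.

(** Since [5 * kappa = 4 * y], Bernoulli's inequality bounds the left side by [(1 - y) ^+ 4]. As
    [r ^+ 8 = (1 + kappa * r) ^+ 4] and [kappa * r <= y], the claim reduces to
    [(1 - y) * (1 + y) <= 1]. *)
Lemma fixed_weight_rate : 1 - 5 * kappa <= (r ^+ 8)^-1.
Proof.
pose y := 5 / 4 * kappa.
have y0 : 0 <= y by rewrite mulr_ge0// ltW.
have y1 : y <= 1 / 4 by rewrite /y; move: kappa_le; lra.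
have r8 : r ^+ 8 = (1 + kappa * r) ^+ 4 by rewrite -r_fixed -exprM.
rewrite -[leRHS]mul1r ler_pdivlMr ?exprn_gt0//.
have b4 : 1 - 5 * kappa <= (1 - y) ^+ 4.
  have -> : (1 - y) ^+ 4 = 1 - 5 * kappa + y ^+ 2 * (6 - 4 * y + y ^+ 2).
    by rewrite /y; field.
  rewrite lerDl mulr_ge0 ?sqr_ge0// addr_ge0 ?sqr_ge0//; lra.
apply: (@le_trans _ _ ((1 - y) ^+ 4 * r ^+ 8)).
  by rewrite ler_pM2r ?exprn_gt0.
rewrite r8 -exprMn exprn_ile1//.
  rewrite mulr_ge0//; first lra.
  by rewrite addr_ge0// mulr_ge0// ltW.
have : kappa * r <= kappa * (6 / 5) by rewrite ler_pM2l// fixed_weight_le.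
have : kappa * r <= y by rewrite /y; have := kappa_gt0; have := fixed_weight_le; nra.
have : 0 <= kappa * r by rewrite mulr_ge0// ltW.
nra.
Qed.

End sinkhorn_weight.

(* The dual functional at the potentials of weight [w], divided by
   [sigma / 2]. *)
Definition weight_dual (R : realType) (kappa w : R) : R :=
  kappa * ln (w / kappa) - w^-1 - (w - kappa).

(* The bound [ln (w / r) <= w / r - 1] leaves an exact square because
   [kappa = r - r^-1]. *)
Lemma weight_dual_gap (R : realType) (kappa r w : R) :
    0 < kappa -> 0 < w -> 0 < r -> r ^+ 2 = 1 + kappa * r ->
  (r - w) ^+ 2 / (r ^+ 2 * w) <= weight_dual kappa r - weight_dual kappa w.
Proof.
move=> k0 w0 r0 rE.
have kE : kappa = r - r^-1 by rewrite {1}(fixed_weightE r0 rE) addrK.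
have wr0 : 0 < w / r by rewrite divr_gt0.
have lnw : ln (w / kappa) = ln (r / kappa) + ln (w / r).
  rewrite -lnM ?posrE ?divr_gt0//; congr ln; field.
  by rewrite !gt_eqF.
have lnle : ln (w / r) <= w / r - 1.
  by rewrite -{1}[w / r](subrKC 1) le_ln1Dx// ltrBrDl subrr.
have : kappa * ln (w / r) <= kappa * (w / r - 1) by rewrite ler_pM2l.
have -> : (r - w) ^+ 2 / (r ^+ 2 * w) =
    - (kappa * (w / r - 1)) - r^-1 + w^-1 - r + w.
  by rewrite kE; field; rewrite !gt_eqF.
rewrite /weight_dual lnw mulrDr; lra.
Qed.

Lemma weight_dual_rate (R : realType) (kappa r : R) (t : nat) :
    0 < kappa -> kappa <= 1 / 5 -> 0 < r -> r ^+ 2 = 1 + kappa * r ->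
  (1 - 5 * kappa) ^+ t / 10 <=
  weight_dual kappa r - weight_dual kappa (sinkhorn_weight kappa t).
Proof.
move=> k0 k5 r0 rE; have w0 := sinkhorn_weight_gt0 k0 t.
apply: le_trans (weight_dual_gap k0 w0 r0 rE).
have wr := ltW (sinkhorn_weight_lt k0 r0 rE t).
set d := r - _; have dE := sinkhorn_weight_gap k0 r0 rE t; rewrite -/d in dE.
have q0 : 0 <= (r ^+ 4)^-1 ^+ t / r.
  by rewrite divr_ge0 ?exprn_ge0 ?invr_ge0 ?exprn_ge0// ltW.
(* The weight stays below [r], so the denominator [r ^+ 2 * w] is at most [r ^+ 3]. *)
apply: (@le_trans _ _ (((r ^+ 4)^-1 ^+ t / r) ^+ 2 / r ^+ 3)); last first.
  apply: ler_pM.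
  - exact: sqr_ge0.
  - by rewrite invr_ge0 exprn_ge0// ltW.
  - by rewrite lerXn2r ?nnegrE// (le_trans q0).
  - rewrite lef_pV2 ?posrE ?exprn_gt0 ?mulr_gt0 ?exprn_gt0//.
    by rewrite (exprSr r 2) ler_pM2l ?exprn_gt0.
have -> : ((r ^+ 4)^-1 ^+ t / r) ^+ 2 / r ^+ 3 = (r ^+ 8)^-1 ^+ t / r ^+ 5.
  rewrite expr_div_n -mulrA -invfM -exprD -exprM mulnC exprM.
  by rewrite (exprVn (r ^+ 4) 2) -exprM.
apply: ler_pM.
- by rewrite exprn_ge0//; lra.
- by rewrite invr_ge0.
- rewrite lerXn2r ?nnegrE ?invr_ge0 ?exprn_ge0 ?(ltW r0)//; first lra.
  exact: fixed_weight_rate.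
- by rewrite lef_pV2 ?posrE ?exprn_gt0// (fixed_weight_expr5 k5 r0 rE).
Qed.

(** * From the weights back to Sinkhorn's iterates and the dual value *)

Section sinkhorn_iterates.
Context (R : realType) (sigma lambda : R).
Hypotheses (sigma_gt0 : 0 < sigma) (lambda_gt0 : 0 < lambda).

Local Notation cost :=
  (fun x y : measurableTypeR R => (- (x * y))%R : Real.sort R).
Local Notation mu := (@centered_gaussian R 1).
Local Notation nu := (@centered_gaussian R sigma).
Local Notation kappa := (lambda / sigma).

Definition weight_potential (k w : R) : measurableTypeR R -> R :=
  quadratic k ((w - kappa) / (2 * sigma)).

(** This is the reason for the variable [w]: the [D] of the right transform is proportional to
    it. *)
Let weight_curvature w :
  w / kappa = 1 + 2 * ((w - kappa) / (2 * sigma)) * sigma ^+ 2 / lambda.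
Proof. by field; rewrite !gt_eqF. Qed.

(** The constant [k] is left unspecified because it cancels in the dual functional once the right
    transform is taken. *)
Lemma sinkhorn_psi_weight t : exists k,
  sinkhorn_psi mu nu cost lambda (fun=> 0) t =
  weight_potential k (sinkhorn_weight kappa t).
Proof.
have k0 : 0 < kappa by rewrite divr_gt0.
elim: t => [|t [k IH]] /=.
  exists 0; apply/funext => y.
  by rewrite /weight_potential /quadratic subrr mul0r mul0r subrr.
have w0 := sinkhorn_weight_gt0 k0 t.
rewrite IH /weight_potential.
rewrite (right_transform_quadratic sigma_gt0 lambda_gt0 k
  (weight_curvature _)) ?divr_gt0//.
set w := sinkhorn_weight kappa t in w0 *.
(* This quantity equals [(kappa + w^-1) / kappa], which is the first half step divided by
   [kappa]. *)
have D0 : 0 < 1 + 2 * (sigma ^+ 2 / (2 * lambda * (w / kappa))) / lambda.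
  by rewrite addr_gt0// !(mulr_gt0, divr_gt0, invr_gt0, exprn_gt0).
rewrite (left_transform_quadratic lambda_gt0 _ erefl D0).
eexists; congr quadratic.
rewrite -/(sinkhorn_weight _ _) -/w.
rewrite [kappa + _]addrC addrK; field.
by rewrite !gt_eqF// addr_gt0// mulr_gt0.
Qed.

Lemma dual_functional_weight (k w : R) : 0 < w ->
  dual_functional mu nu cost lambda
    (right_transform nu cost lambda (weight_potential k w))
    (weight_potential k w) =
  (sigma / 2 * weight_dual kappa w)%:E.
Proof.
move=> w0.
rewrite (dual_functional_quadratic sigma_gt0 lambda_gt0 k
  (weight_curvature w)) ?divr_gt0//.
congr EFin; rewrite /weight_dual.
move: (ln _) => l; field.
by rewrite !gt_eqF.
Qed.

(** Quadratic potentials are integrable against Gaussians, so the pair competes in the supremum. *)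
Lemma dual_value_ge_weight (k w : R) : 0 < w ->
  ((sigma / 2 * weight_dual kappa w)%:E <= dual_value mu nu cost lambda)%E.
Proof.
move=> w0; rewrite -(dual_functional_weight k w0).
apply: ereal_sup_ubound; eexists; eexists; split; last by [].
- rewrite (right_transform_quadratic sigma_gt0 lambda_gt0 k
    (weight_curvature w)) ?divr_gt0//.
  exact: integrable_quadratic (oner_neq0 _).
- by apply: integrable_quadratic; rewrite gt_eqF.
Qed.

End sinkhorn_iterates.

Theorem theorem1p3 (R : realType) (sigma lambda : R)
    (sigma_gt0 : 0 < sigma) (lambda_gt0 : 0 < lambda)
    (lambda_le : lambda <= sigma / 5) (t : nat) :
  ((sigma / 20 * (1 - 5 * lambda / sigma) ^+ t)%:E <=
   dual_gap (centered_gaussian 1) (centered_gaussian sigma)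
     (fun x y => (- (x * y))%R) lambda (fun=> 0%R) t)%E.
Proof.
pose kappa := lambda / sigma.
have k0 : 0 < kappa by rewrite divr_gt0.
have k5 : kappa <= 1 / 5 by rewrite ler_pdivrMr// mul1r mulrC.
(* The positive root of [r ^+ 2 = 1 + kappa * r]. *)
pose r := (kappa + Num.sqrt (kappa ^+ 2 + 4)) / 2.
have r0 : 0 < r by rewrite divr_gt0// ltr_wpDr// sqrtr_ge0.
have rE : r ^+ 2 = 1 + kappa * r.
  have s4 : Num.sqrt (kappa ^+ 2 + 4) ^+ 2 = kappa ^+ 2 + 4.
    by rewrite sqr_sqrtr// addr_ge0// sqr_ge0.
  rewrite /r; move: (Num.sqrt _) s4 => s s4.
  have -> : ((kappa + s) / 2) ^+ 2 = (kappa ^+ 2 + 2 * kappa * s + s ^+ 2) / 4.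
    by field.
  by rewrite s4; field.
have w0 := sinkhorn_weight_gt0 k0 t.
rewrite /dual_gap /sinkhorn_phi.
have [k ->] := sinkhorn_psi_weight sigma_gt0 lambda_gt0 t.
rewrite (dual_functional_weight sigma_gt0 lambda_gt0 k w0) leeBrDr//.
(* The competitor is the potential of the fixed weight [r]; its constant 0 is arbitrary. *)
apply: le_trans (dual_value_ge_weight sigma_gt0 lambda_gt0 0 r0).
rewrite -EFinD lee_fin -lerBrDr -mulrBr -/kappa.
have -> : sigma / 20 * (1 - 5 * lambda / sigma) ^+ t =
    sigma / 2 * ((1 - 5 * kappa) ^+ t / 10).
  by rewrite -(mulrA 5) -/kappa; field.
rewrite ler_pM2l ?divr_gt0//.
exact: weight_dual_rate.
Qed.
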